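(* Let $N\ge 1$, $L>0$, and let $J=(W,B)$ be a generic instance, i.e. $W=\{w_1<\dots<w_N\}$ and $B=\{b_1<\dots<b_N\}$ are sets of $N$ white and $N$ black points in $[0,L]$ such that no two of the $2N$ coordinates coincide. Let $\pi\in\mathfrak S_N$. Then $\pi$ is an optimal matching of $J$ (that is, $\pi\in\mathcal Z_J$) if and only if the functions $k_{\rm LB}$ and $k_\pi$ coincide, i.e. $k_{\rm LB}(z)=k_\pi(z)$ for all $z\in\mathbb R\setminus(W\cup B)$.
   Context: $\mathfrak S_N$ is the set of permutations of $\{1,\dots,N\}$; $\pi\in\mathfrak S_N$ is identified with the perfect matching linking the white point $w_i$ to the black point $b_{\pi(i)}$ for each $i$. The cost (linear cost function, $p=1$, dimension $d=1$) is $H_J(\pi)=\sum_{i=1}^N |w_i-b_{\pi(i)}|$, and $\mathcal Z_J\subseteq\mathfrak S_N$ is the set of all $\pi$ minimizing $H_J$ over $\mathfrak S_N$ (optimal matchings). For $z\in\mathbb R\setminus (W\cup B)$ define $$k_\pi(z)=\sum_{i=1}^N\kappa(z,w_i,b_{\pi(i)}),\qquad \kappa(z,x,y)=\begin{cases}1 & x<z<y \text{ or } y<z<x,\\ 0&\text{otherwise,}\end{cases}$$ and $$k_{\rm LB}(z)=\big|\#(W\cap[0,z])-\#(B\cap[0,z])\big|,$$ where $\#(I)$ denotes the cardinality of the set $I$. *)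

(* Defs.v *)
From HB Require Import structures.
From mathcomp Require Import all_boot all_order all_algebra all_fingroup.
From mathcomp Require Import finmap reals.
Set Implicit Arguments.
Unset Strict Implicit.
Unset Printing Implicit Defensive.
Import Order.TTheory GRing.Theory Num.Theory.
Local Open Scope ring_scope.
Local Open Scope fset_scope.

Section Matching.
Variables (R : realType) (N : nat).
Implicit Types (w b : 'I_N -> R) (pi : 'S_N) (z : R).

(* An instance J = (W, B) is given by the increasing enumerations w and b of
   W and B, indexed from 0 instead of 1. *)
Definition generic_instance (L : R) w b : Prop :=
  [/\ forall i, 0 <= w i <= L,
      forall i, 0 <= b i <= L,
      forall i j : 'I_N, (i < j)%N -> w i < w j,
      forall i j : 'I_N, (i < j)%N -> b i < b j
    & forall i j : 'I_N, w i != b j].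

Definition points (x : 'I_N -> R) : {fset R} := [fset x i | i in 'I_N].

Definition cost w b pi : R := \sum_(i < N) `|w i - b (pi i)|.

Definition optimal_matchings w b : {set 'S_N} :=
  [set pi : 'S_N | [forall sigma : 'S_N, cost w b pi <= cost w b sigma]].

Definition kappa z (x y : R) : nat :=
  if (x < z < y) || (y < z < x) then 1 else 0.

Definition k_matching w b pi z : nat :=
  (\sum_(i < N) kappa z (w i) (b (pi i)))%N.

Definition card_upto (A : {fset R}) z : nat :=
  #|` [fset x in A | 0 <= x <= z] |.

(* The difference is taken in int, since subtraction on nat is truncated. *)
Definition k_LB w b z : nat :=
  absz ((card_upto (points w) z)%:Z - (card_upto (points b) z)%:Z).

End Matching.

(* Main.v *)
(** Each arc contributes to its length exactly the gaps between consecutive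
    points that it covers, so the cost of a matching is the sum of its crossing
    numbers [k_matching], weighted by the gap lengths; as [k_LB] is a
    pointwise lower bound of every [k_matching], a matching that attains it is
    optimal.  Conversely, the bound is attained at [z] unless two arcs cross [z]
    in opposite directions, and exchanging the ends of two such arcs strictly
    decreases the cost. *)
Require Import Defs.
From HB Require Import structures.
From mathcomp Require Import all_boot all_order all_algebra all_fingroup.
From mathcomp Require Import finmap reals.
From mathcomp Require Import lra.
Import Order.TTheory GRing.Theory Num.Theory.
Local Open Scope fset_scope.
Local Open Scope ring_scope.

(** An arc covers [z] exactly when one end lies left of [z] and the other right, so the indicators
    of the two ends differ. *)
Lemma kappaE {R : realType} (z x y : R) : z != x -> z != y ->
  kappa z x y = absz ((x <= z)%R%:Z - (y <= z)%R%:Z).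
Proof.
by rewrite /kappa; case: (ltgtP x z); case: (ltgtP y z).
Qed.

Lemma kappa_lt {R : realType} (z x y : R) : z != x -> z != y ->
  (kappa z x y)%:R = `|(z < x)%R%:R - (z < y)%R%:R| :> R.
Proof.
rewrite /kappa; case: (ltgtP x z); case: (ltgtP y z) => //= _ _ _ _;
  by rewrite ?subrr ?subr0 ?sub0r ?normrN ?normr0 ?normr1.
Qed.

(* [G] lists the gaps as pairs (a point inside the gap, its length). *)
Lemma path_gap_sum {R : realType} (a : R) (s : seq R) : path <%R a s ->
  exists G : seq (R * R),
    (forall p, p \in G -> [/\ 0 <= p.2, a < p.1 & p.1 \notin s]) /\
    (forall x, x \in a :: s -> x = a + \sum_(p <- G) p.2 * (p.1 < x)%R%:R).
Proof.
elim: s a => [|b s IHs] a /=.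
  move=> _; exists [::]; split=> // x; rewrite inE => /eqP ->.
  by rewrite big_nil addr0.
case/andP=> ltab pbs; have [G [HG Hx]] := IHs b pbs.
have geb x : x \in b :: s -> b <= x.
  rewrite inE => /predU1P[-> // | xs].
  by move: pbs; rewrite (path_sortedE lt_trans) => /andP[/allP/(_ x xs)/ltW].
(* The new gap runs from [a] to [b]; its midpoint serves as the point inside it. *)
exists (((a + b) / 2, b - a) :: G); split=> [p | x].
  rewrite inE => /predU1P[-> /= | /HG[p2 p1 ps]].
    split; [lra | lra |].
    by apply/negP => /geb; lra.
  split=> //; first exact: lt_trans p1.
  by rewrite inE negb_or ps andbT gt_eqF.
rewrite inE big_cons /= => /predU1P[-> | xs].
  (* For [x = a] the sum vanishes: every sample point lies to the right of [a]. *)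
  rewrite [_ < a]lt_gtF ?mulr0 ?add0r; last by lra.
  rewrite big_seq big1 ?addr0 // => p /HG[_ p1 _].
  by rewrite lt_gtF ?mulr0 //; apply: lt_trans p1.
have lt_mid : (a + b) / 2 < x by have := geb x xs; lra.
by rewrite lt_mid mulr1 {1}(Hx x xs); lra.
Qed.

(** Each point of [s] is the least one plus the gaps to its left, so in a difference only the gaps
    between [x] and [y] survive. *)
Lemma dist_gap_sum {R : realType} (s : seq R) :
  exists G : seq (R * R),
    (forall p, p \in G -> 0 <= p.2 /\ p.1 \notin s) /\
    (forall x y, x \in s -> y \in s ->
       `|x - y| = \sum_(p <- G) p.2 * (kappa p.1 x y)%:R).
Proof.
have memE : sort <=%R (undup s) =i s by move=> x; rewrite mem_sort mem_undup.
have : sorted <%R (sort <=%R (undup s)).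
  by rewrite lt_sorted_uniq_le sort_uniq undup_uniq sort_le_sorted.
case: (sort _ _) memE => [|a t] memE /=.
  by move=> _; exists [::]; split=> // x y; rewrite -memE.
case/path_gap_sum => G [HG Hx]; exists G.
have HG' p : p \in G -> 0 <= p.2 /\ p.1 \notin s.
  by move=> /HG[p2 p1 pt]; rewrite -memE inE negb_or pt gt_eqF.
split=> //; move=> x y xs ys.
wlog lexy : x y xs ys / x <= y.
  move=> W; have [/W-> // | /ltW/W W'] := leP x y.
  rewrite distrC W' //; apply: eq_bigr => p _.
  by rewrite /kappa orbC.
rewrite distrC ger0_norm ?subr_ge0 //.
rewrite {1}(Hx y) ?memE // {1}(Hx x) ?memE // opprD addrACA subrr add0r.
rewrite -sumrB big_seq [RHS]big_seq; apply: eq_bigr => p /HG'[_ pNs].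
have pN u : u \in s -> p.1 != u by apply: contraTneq => <-.
(* Since [x <= y], a sample point left of [x] is also left of [y]; the difference of indicators is
   nonnegative and the absolute value drops. *)
rewrite kappa_lt ?pN // -mulrBr distrC ger0_norm // subr_ge0 ler_nat.
by case: (ltP p.1 x) => // /lt_le_trans/(_ lexy) ->.
Qed.

Section Crossings.
Set Implicit Arguments.
Unset Strict Implicit.
Context {R : realType} {N : nat}.
Implicit Types (w b x : 'I_N -> R) (pi : 'S_N) (z : R).

(** Off the points this is signed: [1] if the arc from white to black passes [z] rightwards, [-1] if
    leftwards, [0] if it does not cross [z]. *)
Definition crossing w b pi z (i : 'I_N) : int :=
  (w i <= z)%R%:Z - (b (pi i) <= z)%R%:Z.

Lemma mem_points x i : x i \in points x.
Proof. by apply/imfsetP; exists i. Qed.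

Lemma card_upto_points x z : injective x -> (forall i, 0 <= x i) ->
  card_upto (points x) z = (\sum_(i < N) (x i <= z)%R)%N.
Proof.
move=> x_inj x_ge0; rewrite /card_upto.
have -> : [fset y in points x | 0 <= y <= z]
        = [fset x i | i in [pred i | x i <= z]].
  apply/fsetP => y; rewrite !inE; apply/andP/imfsetP => /=.
    case=> /imfsetP[i _ ->] /andP[_ xz].
    by exists i.
  by case=> i xz ->; rewrite mem_points x_ge0.
rewrite card_imfset //= -cardE -sum1_card big_mkcond /=.
by apply: eq_bigr => i _; rewrite unfold_in /=; case: (x i <= z).
Qed.

(** Reindexing the black points by [pi] does not change their count, so the net crossing number is
    the same for every matching. *)
Lemma k_LB_crossing w b pi z : injective w -> injective b ->
    (forall i, 0 <= w i) -> (forall i, 0 <= b i) ->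
  k_LB w b z = absz (\sum_(i < N) crossing w b pi z i).
Proof.
move=> w_inj b_inj w_ge0 b_ge0; rewrite /k_LB !card_upto_points //.
rewrite [X in _ - X%:Z](reindex_inj (@perm_inj _ pi)) /=.
by rewrite /crossing sumrB !(big_morph Posz PoszD erefl).
Qed.

Lemma k_matching_crossing w b pi z : z \notin points w `|` points b ->
  k_matching w b pi z = (\sum_(i < N) absz (crossing w b pi z i))%N.
Proof.
rewrite inE negb_or => /andP[zw zb]; apply: eq_bigr => i _.
by apply: kappaE; [apply: contraNneq zw | apply: contraNneq zb] => ->;
  apply: mem_points.
Qed.

Lemma leq_abszn_sum (c : 'I_N -> int) :
  (absz (\sum_(i < N) c i)%R <= \sum_(i < N) absz (c i))%N.
Proof.
rewrite -lez_nat (big_morph Posz PoszD erefl) abszE.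
by under eq_bigr do rewrite abszE; apply: ler_norm_sum.
Qed.

Lemma k_LB_le_k_matching w b pi z : injective w -> injective b ->
    (forall i, 0 <= w i) -> (forall i, 0 <= b i) ->
    z \notin points w `|` points b ->
  (k_LB w b z <= k_matching w b pi z)%N.
Proof.
move=> w_inj b_inj w_ge0 b_ge0 zN.
by rewrite (k_LB_crossing pi) // k_matching_crossing // leq_abszn_sum.
Qed.

(** The gaps depend only on the point set, so a single [G] serves all matchings, which can then be
    compared gap by gap. *)
Lemma cost_k_matching w b : exists G : seq (R * R),
  (forall p, p \in G -> 0 <= p.2 /\ p.1 \notin points w `|` points b) /\
  (forall pi, cost w b pi = \sum_(p <- G) p.2 * (k_matching w b pi p.1)%:R).
Proof.
have [G [HG Hd]] := dist_gap_sum (enum_fset (points w `|` points b)).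
exists G; split=> [//|pi]; under [RHS]eq_bigr do rewrite natr_sum mulr_sumr.
rewrite exchange_big; apply: eq_bigr => i _.
by apply: Hd; rewrite inE mem_points ?orbT.
Qed.

(** After the exchange one arc has both ends at or left of [z] and the other both ends right of it,
    so the stretch around [z] that both old arcs covered is saved. *)
Lemma cost_tperm_lt w b pi z i j :
    w i <= z -> z < b (pi i) -> b (pi j) <= z -> z < w j ->
  cost w b (tperm i j * pi)%g < cost w b pi.
Proof.
move=> wi bi bj wj.
have ji : j != i by apply: contraTneq wj => ->; rewrite -leNgt.
rewrite /cost (bigD1 i) //= (bigD1 j) //=
  [ltRHS](bigD1 i) //= [ltRHS in _ < _ + ltRHS](bigD1 j) //=.
rewrite !addrA !permM tpermL tpermR.
rewrite [X in _ + X < _](eq_bigr (fun k => `|w k - b (pi k)|)); last first.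
  by move=> k /andP[ki kj]; rewrite permM tpermD // eq_sym.
rewrite ltrD2r [ltRHS]addrC.
rewrite (ltr0_norm (x := w i - b (pi i))); last lra.
rewrite (gtr0_norm (x := w j - b (pi j))); last lra.
have [|] := leP 0 (w i - b (pi j)) => h1; have [|] := leP 0 (w j - b (pi i)) => h2;
rewrite ?(ger0_norm h1) ?(ger0_norm h2) ?(ltr0_norm h1) ?(ltr0_norm h2); lra.
Qed.

(** This is the equality case of the triangle inequality; a family with a negative term has no
    positive one, and negation reduces it to the nonnegative case. *)
Lemma absz_sum_same_sign (c : 'I_N -> int) :
    (forall i j, 0 < c i -> c j < 0 -> False) ->
  absz (\sum_(i < N) c i) = (\sum_(i < N) absz (c i))%N.
Proof.
have pos (d : 'I_N -> int) : (forall i, 0 <= d i) ->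
    absz (\sum_(i < N) d i) = (\sum_(i < N) absz (d i))%N.
  move=> d0; apply/eqP; rewrite -eqz_nat (big_morph Posz PoszD erefl).
  rewrite gez0_abs ?sumr_ge0 //; apply/eqP/eq_bigr => i _.
  by rewrite gez0_abs.
move=> same; case: (boolP [forall i, 0 <= c i]) => [/forallP/pos // |].
rewrite negb_forall => /existsP[j]; rewrite -ltNge => cj.
rewrite -abszN -sumrN pos => [|i].
  by apply: eq_bigr => i _; rewrite abszN.
by rewrite oppr_ge0 leNgt; apply/negP => /same /(_ cj).
Qed.

Lemma optimal_k_matching w b pi z : injective w -> injective b ->
    (forall i, 0 <= w i) -> (forall i, 0 <= b i) ->
    pi \in optimal_matchings w b -> z \notin points w `|` points b ->
  k_LB w b z = k_matching w b pi z.
Proof.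
move=> w_inj b_inj w_ge0 b_ge0; rewrite inE => /forallP opt zN.
rewrite (k_LB_crossing pi) // k_matching_crossing //.
apply: absz_sum_same_sign => i j; rewrite /crossing.
(* Only a rightward arc [i] and a leftward arc [j] survive the case split; exchanging their ends
   would contradict optimality. *)
case: (leP (w i) z) => wi; case: (leP (b (pi i)) z) => bi //.
case: (leP (w j) z) => wj; case: (leP (b (pi j)) z) => bj // _ _.
by have := cost_tperm_lt wi bi bj wj; rewrite ltNge opt.
Qed.

Lemma k_matching_optimal w b pi : injective w -> injective b ->
    (forall i, 0 <= w i) -> (forall i, 0 <= b i) ->
    (forall z, z \notin points w `|` points b ->
       k_LB w b z = k_matching w b pi z) ->
  pi \in optimal_matchings w b.
Proof.
move=> w_inj b_inj w_ge0 b_ge0 eqk; rewrite inE; apply/forallP => sigma.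
have [G [HG Hcost]] := cost_k_matching w b.
(* In each gap [pi] attains [k_LB], which bounds the crossing number of [sigma] from below, and the
   gap lengths are nonnegative. *)
rewrite !Hcost big_seq [leRHS]big_seq; apply: ler_sum => p /HG[p2 pN].
by rewrite ler_wpM2l // ler_nat -eqk // k_LB_le_k_matching.
Qed.

Lemma increasing_inj (x : 'I_N -> R) :
  (forall i j : 'I_N, (i < j)%N -> x i < x j) -> injective x.
Proof.
move=> x_lt i j xij; apply: val_inj => /=.
by case: (ltngtP i j) => // /x_lt; rewrite xij ltxx.
Qed.

End Crossings.

Theorem corollary1 (R : realType) (N : nat) (L : R) (w b : 'I_N -> R)
    (hN : (1 <= N)%N) (hL : 0 < L) (hJ : generic_instance L w b) (pi : 'S_N) :
  pi \in optimal_matchings w b <->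
  (forall z : R, z \notin points w `|` points b ->
     k_LB w b z = k_matching w b pi z).
Proof.
case: hJ => w0L b0L /increasing_inj w_inj /increasing_inj b_inj _.
have w_ge0 i : 0 <= w i by case/andP: (w0L i).
have b_ge0 i : 0 <= b i by case/andP: (b0L i).
split=> [opt z|]; first exact: optimal_k_matching.
exact: k_matching_optimal.
Qed.
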